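(* Let $G$ be a connected graph of radius $\mathrm{rad}(G)\geq 1$. Then $\gamma_e(G)\leq 2^{2\,\mathrm{rad}(G)-2}$, where $\gamma_e(G)$ is the exponential domination number of $G$.
   Context: All graphs are finite, simple, and undirected. Let $G$ be a graph and $S\subseteq V(G)$. For two vertices $u,v$ of $G$ with $u\in S$ or $v\in S$, let $\mathrm{dist}_{(G,S)}(u,v)$ be the minimum number of edges of a path $P$ in $G$ between $u$ and $v$ such that $S$ contains exactly one endvertex of $P$ and no internal vertex of $P$; if no such path exists, $\mathrm{dist}_{(G,S)}(u,v)=\infty$. (Thus $\mathrm{dist}_{(G,S)}(u,u)=0$ for $u\in S$, and $\mathrm{dist}_{(G,S)}(u,v)=\infty$ for distinct $u,v\in S$.) For a vertex $u$ of $G$, let $$w_{(G,S)}(u)=\sum_{v\in S}\left(\tfrac12\right)^{\mathrm{dist}_{(G,S)}(u,v)-1},\qquad \left(\tfrac12\right)^{\infty}=0,$$ so that $w_{(G,S)}(u)=2$ for $u\in S$. The set $S$ is an exponential dominating set of $G$ if $w_{(G,S)}(u)\geq 1$ for every vertex $u$ of $G$. The exponential domination number $\gamma_e(G)$ is the minimum order of an exponential dominating set of $G$. *)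

(* Defs.v *)
From mathcomp Require Import all_boot all_order all_algebra.

Set Implicit Arguments.
Unset Strict Implicit.
Unset Printing Implicit Defensive.

Import GRing.Theory.

(* A finite simple graph is a finType [T] of vertices with a symmetric and
   irreflexive adjacency relation [e : rel T]. *)
Definition simple_graph (T : finType) (e : rel T) : Prop :=
  symmetric e /\ irreflexive e.

Definition connected_graph (T : finType) (e : rel T) : Prop :=
  0 < #|T| /\ forall u v : T, connect e u v.

(* [p] lists the vertices that follow [u], so the path has [size p] edges and
   its internal vertices are [behead (belast u p)]. *)
Definition gpath (T : finType) (e : rel T) (u v : T) (p : seq T) : bool :=
  [&& path e u p, last u p == v & uniq (u :: p)].

(* The endvertices form the set [[set u; v]], so that the path with the single
   vertex [u \in S] has exactly one endvertex in [S]. *)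
Definition Spath (T : finType) (e : rel T) (S : {set T}) (u v : T)
    (p : seq T) : bool :=
  [&& gpath e u v p, #|[set u; v] :&: S| == 1
    & all (fun x => x \notin S) (behead (belast u p))].

(* Least [size p] over the [p] satisfying [P], with [None] for infinity.  Only
   sizes below [#|T|] are searched, since a path has fewer edges than the graph
   has vertices; see [gdistP] and [SdistP]. *)
Definition min_size (T : finType) (P : pred (seq T)) : option nat :=
  ohead [seq k <- iota 0 #|T| | [exists p : k.-tuple T, P p]].

Definition gdist (T : finType) (e : rel T) (u v : T) : option nat :=
  min_size (gpath e u v).

Definition Sdist (T : finType) (e : rel T) (S : {set T}) (u v : T) :
    option nat :=
  min_size (Spath e S u v).

(* Finite distances are smaller than [#|T|], which stands for infinity here;
   it is never reached in a connected graph. *)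
Definition ecc (T : finType) (e : rel T) (u : T) : nat :=
  \max_(v : T) odflt #|T| (gdist e u v).

(* The default [#|T|] only matters for the graph without vertices; see
   [radiusP]. *)
Definition radius (T : finType) (e : rel T) : nat :=
  \big[minn/#|T|]_(u : T) ecc e u.

(* (1/2)^(d-1), with an integer exponent: the value is 2 at d = 0. *)
Definition half_pow (d : option nat) : rat :=
  (if d is Some k then (1 / 2%:R) ^ (k%:Z - 1) else 0)%R.

Definition weight (T : finType) (e : rel T) (S : {set T}) (u : T) : rat :=
  (\sum_(v in S) half_pow (Sdist e S u v))%R.

Definition exp_dominating (T : finType) (e : rel T) (S : {set T}) : bool :=
  [forall u : T, (1 <= weight e S u)%R].

(* The default [#|T|] is the order of [setT], which is always exponentially
   dominating, so this is a minimum over a nonempty family; see [gamma_eP]. *)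
Definition gamma_e (T : finType) (e : rel T) : nat :=
  \big[minn/#|T|]_(S : {set T} | exp_dominating e S) #|S|.

Lemma min_sizeP (T : finType) (P : pred (seq T)) :
  (forall p, P p -> size p < #|T|) ->
  match min_size P with
  | Some k => (exists2 p, P p & size p = k) /\ (forall p, P p -> k <= size p)
  | None => forall p, ~~ P p
  end.
Proof.
move=> Pb; rewrite /min_size; set s := filter _ _.
have memP p : P p -> size p \in s.
  move=> Pp; rewrite mem_filter mem_iota leq0n add0n Pb ?andbT //.
  by apply/existsP; exists (in_tuple p).
have: sorted leq s.
  apply: (@sorted_filter _ leq leq_trans); exact: iota_sorted.
have: {subset s <= [pred k | [exists p : k.-tuple T, P p]]}.
  by move=> k; rewrite mem_filter => /andP[].
case: s memP => [|k s] memP sub sorted_s /=.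
  by move=> p; apply/negP => /memP.
split.
  have /existsP[p Pp] := sub k (mem_head k s).
  by exists p; rewrite ?size_tuple.
move=> p /memP; rewrite inE => /orP[/eqP -> //|].
by apply: (allP (order_path_min leq_trans sorted_s)).
Qed.

Lemma gpath_size (T : finType) (e : rel T) u v p :
  gpath e u v p -> size p < #|T|.
Proof.
by case/and3P=> _ _ /card_uniqP/= size_p; rewrite -size_p; exact: max_card.
Qed.

Lemma gdistP (T : finType) (e : rel T) (u v : T) :
  match gdist e u v with
  | Some k => (exists2 p, gpath e u v p & size p = k)
              /\ (forall p, gpath e u v p -> k <= size p)
  | None => forall p, ~~ gpath e u v p
  end.
Proof. by apply: min_sizeP => p; exact: gpath_size. Qed.

Lemma SdistP (T : finType) (e : rel T) (S : {set T}) (u v : T) :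
  match Sdist e S u v with
  | Some k => (exists2 p, Spath e S u v p & size p = k)
              /\ (forall p, Spath e S u v p -> k <= size p)
  | None => forall p, ~~ Spath e S u v p
  end.
Proof. by apply: min_sizeP => p /and3P[/gpath_size]. Qed.

Lemma Sdist_id (T : finType) (e : rel T) (S : {set T}) (u : T) :
  u \in S -> Sdist e S u u = Some 0.
Proof.
move=> uS; have Pu : Spath e S u u [::].
  rewrite /Spath /gpath /= eqxx /= setUid andbT; apply/eqP.
  by rewrite (setIidPl _) ?cards1 // sub1set.
have := SdistP e S u u; case: Sdist => [k|/(_ [::])]; last by rewrite Pu.
by case=> _ /(_ _ Pu); rewrite leqn0 => /eqP->.
Qed.

Lemma Sdist_in (T : finType) (e : rel T) (S : {set T}) (u v : T) :
  u \in S -> v \in S -> u != v -> Sdist e S u v = None.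
Proof.
move=> uS vS nuv; have := SdistP e S u v; case: Sdist => // k [[p + _] _].
case/and3P=> _ + _; rewrite (setIidPl _) ?cards2 ?nuv //.
by apply/subsetP=> x; rewrite !inE => /orP[]/eqP->.
Qed.

Lemma weight_in (T : finType) (e : rel T) (S : {set T}) (u : T) :
  u \in S -> weight e S u = 2%:R%R.
Proof.
move=> uS; rewrite /weight (bigD1 u) //= Sdist_id // big1 ?addr0 //.
by move=> v /andP[vS nvu]; rewrite Sdist_in // eq_sym.
Qed.

Lemma exp_dominatingT (T : finType) (e : rel T) : exp_dominating e [set: T].
Proof. by apply/forallP => u; rewrite weight_in ?inE. Qed.

Lemma big_minn_le (I : finType) (P : pred I) (F : I -> nat) x i :
  P i -> \big[minn/x]_(j | P j) F j <= F i.
Proof.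
rewrite unlock => Pi; have := mem_index_enum i.
elim: (index_enum I) => //= j s IHs; rewrite inE.
case/orP=> [/eqP<-|/IHs le_s]; first by rewrite Pi geq_minl.
by case: (P j) => //; apply: leq_trans le_s; exact: geq_minr.
Qed.

Lemma gamma_eP (T : finType) (e : rel T) :
  (exists2 S : {set T}, exp_dominating e S & #|S| = gamma_e e)
  /\ (forall S : {set T}, exp_dominating e S -> gamma_e e <= #|S|).
Proof.
split=> [|S eS]; last exact: big_minn_le.
rewrite /gamma_e; elim/big_ind: _.
- by exists setT; rewrite ?cardsT ?exp_dominatingT.
- by move=> x y Ex Ey; rewrite /minn; case: ifP.
- by move=> S eS; exists S.
Qed.

Lemma gdist_connected (T : finType) (e : rel T) (u v : T) :
  connected_graph e -> exists2 k, gdist e u v = Some k & k < #|T|.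
Proof.
case=> _ /(_ u v) /connectP[p0 /shortenP[p ep up _] def_v].
have Pp : gpath e u v p by rewrite /gpath ep up def_v eqxx.
have := gdistP e u v; case: gdist => [k [[q /gpath_size + <-] _]|/(_ p)].
  by exists (size q).
by rewrite Pp.
Qed.

Lemma eccP (T : finType) (e : rel T) (u : T) :
  connected_graph e ->
  (exists v : T, gdist e u v = Some (ecc e u))
  /\ (forall v k, gdist e u v = Some k -> k <= ecc e u).
Proof.
move=> conn; split=> [|v k duv].
  have [|v ecc_v] := @bigop.eq_bigmax T (fun v => odflt #|T| (gdist e u v)).
    by case: conn.
  exists v; rewrite /ecc ecc_v.
  by have [k -> _] := gdist_connected u v conn.
by rewrite /ecc (bigD1 v) //= duv leq_maxl.
Qed.

Lemma radiusP (T : finType) (e : rel T) :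
  connected_graph e ->
  (exists u : T, ecc e u = radius e) /\ (forall u : T, radius e <= ecc e u).
Proof.
move=> conn; split=> [|u]; last exact: big_minn_le.
have le_ecc u : ecc e u < #|T|.
  have [[v duv] _] := eccP u conn.
  by have [k + lt_k] := gdist_connected u v conn; rewrite duv => -[->].
have [u0 _]: exists u0 : T, true.
  by have [/card_gt0P[u0 _] _] := conn; exists u0.
have: (exists u : T, ecc e u = radius e) \/ radius e = #|T|.
  rewrite /radius; elim/big_ind: _ => [|x y Ex Ey|u _]; first by right.
    by rewrite /minn; case: ifP.
  by left; exists u.
case=> // rT; have := big_minn_le (P := xpredT) (ecc e) #|T| (i := u0) isT.
by rewrite -/(radius e) rT leqNgt le_ecc.
Qed.

(* Main.v *)
(* Let [K = rad G - 1], and let a spanning tree of shortest paths be rooted at a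
   central vertex [c], so that all depths are at most [K + 1].  Give a vertex [x]
   of depth at most [K] the value
     [n x = max (2 ^ (K - depth x)) (sum of n y over the children y of x)],
   where only children of depth at most [K] count; this is the largest
   weight of an antichain of the subtree of [x] when [p] has weight
   [2 ^ (K - depth p)].  Call [x] closed if the children sum is smaller than
   [2 ^ (K - depth x)].  The subtree of [x] contains at most [n x] closed
   vertices, and the topmost ones have total weight exactly [n x].  Hence an
   open [x] gets enough weight from the topmost closed vertices below it, and a
   vertex of depth [K + 1] has a closed parent: the closed vertices of a subtree
   dominate that subtree.
   If [n c <= 4 ^ K], take all closed vertices.  Otherwise the topmost ones
   contain a subset [P] of weight exactly [4 ^ K]; take the closed vertices at or
   below [P].  There are at most [4 ^ K] of them, and a vertex outside the
   subtrees of [P] reaches every [p] in [P] through [c] without meeting the set,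
   in at most [K + 1 + depth p] steps, which gives it weight at least
   [4 ^ K * 2 ^ - 2 K = 1]. *)

Require Import Defs.
From mathcomp Require Import all_boot all_order all_algebra.
From mathcomp Require Import zify.

Set Implicit Arguments.
Unset Strict Implicit.
Unset Printing Implicit Defensive.

Import Order.TTheory GRing.Theory Num.Theory.

(** * Unions, and subsets of prescribed dyadic weight *)

Lemma card_bigcup_le (I U : finType) (P : pred I) (F : I -> {set U}) :
  #|\bigcup_(i | P i) F i| <= \sum_(i | P i) #|F i|.
Proof.
elim/big_rec2: _ => [|i n A _ le]; first by rewrite cards0.
by rewrite (leq_trans (leq_card_setU _ _)) // leq_add2l.
Qed.

(* Dropping an element of least exponent keeps the sum a multiple of its weight,
   so the sum cannot jump over [2 ^ M]. *)
Lemma exact_pow2_subset (T : finType) (A : {set T}) (f : T -> nat) (M : nat) :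
  {in A, forall x, f x <= M} -> 2 ^ M <= \sum_(x in A) 2 ^ f x ->
  exists2 B : {set T}, B \subset A & \sum_(x in B) 2 ^ f x = 2 ^ M.
Proof.
have [n] := ubnP #|A|; elim: n A => // n IHn A ltA fM leM.
move: (leM); rewrite leq_eqVlt => /orP[/eqP eqM|ltM]; first by exists A.
have [x0 Ax0] : exists x, x \in A.
  apply/set0Pn; apply: contraTneq leM => ->.
  by rewrite big_set0 -ltnNge expn_gt0.
case: (arg_minnP f Ax0) => x xA minx; have Ax : x \in A by [].
have dvdA : 2 ^ f x %| \sum_(y in A) 2 ^ f y.
  by apply: dvdn_sum => y Ay; apply: dvdn_exp2l; apply: minx.
have dvdM : 2 ^ f x %| 2 ^ M by apply: dvdn_exp2l; apply: fM.
have [|||B sBA sumB] := IHn (A :\ x).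
- by rewrite (cardsD1 x A) Ax in ltA.
- by move=> y /setD1P[_ /fM].
- have -> : \sum_(y in A :\ x) 2 ^ f y = \sum_(y in A) 2 ^ f y - 2 ^ f x.
    rewrite [in RHS](big_setD1 x) //= addnC addnK //.
  have: 2 ^ f x <= \sum_(y in A) 2 ^ f y - 2 ^ M.
    by apply: dvdn_leq; rewrite ?subn_gt0 ?dvdn_sub.
  lia.
by exists B => //; apply: subset_trans sBA _; apply: subD1set.
Qed.

(** * Distances from a root *)

Lemma gdist_path_le (T : finType) (e : rel T) (u v : T) (p : seq T) :
  path e u p -> last u p = v -> exists2 k, gdist e u v = Some k & k <= size p.
Proof.
move=> ep lp; move: (lp); case/shortenP: ep => q eq uq sub_qp lq.
have Pq : gpath e u v q by rewrite /gpath eq lq eqxx.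
have := gdistP e u v; case: gdist => [k [_ /(_ q Pq) lek]|/(_ q)].
  exists k => //; apply: leq_trans lek _; apply: uniq_leq_size sub_qp.
  by case/andP: uq.
by rewrite Pq.
Qed.

(** Take the penultimate vertex of a shortest path: its prefix bounds one distance, and extending a
    shortest path by the last edge bounds the other. *)
Lemma gdist_predecessor (T : finType) (e : rel T) (c u : T) :
  symmetric e -> connect e c u -> u != c ->
  exists2 v, e u v & (odflt 0 (gdist e c v)).+1 = odflt 0 (gdist e c u).
Proof.
move=> sym_e /connectP[p0 ep0 lp0] uc.
have [k duk _] := gdist_path_le ep0 (esym lp0).
have := gdistP e c u; rewrite duk => -[[p /and3P[ep /eqP lp _] sp] mink].
case: (lastP p) ep lp sp => [_ eq_cu|q w]; first by rewrite -eq_cu eqxx in uc.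
rewrite rcons_path last_rcons size_rcons => /andP[eq eqw] def_w sq.
subst w; have [m dvm lem] := gdist_path_le eq erefl.
exists (last c q); first by rewrite sym_e.
rewrite dvm /=; apply/eqP; rewrite eqn_leq -[in X in X && _]sq ltnS lem /=.
have := gdistP e c (last c q); rewrite dvm => -[[q' /and3P[eq' /eqP lq' _] sq'] _].
have := @gdist_path_le _ e c u (rcons q' u); rewrite rcons_path lq' eq' eqw.
rewrite last_rcons size_rcons sq' duk => /(_ isT erefl) [_ [<-] //].
Qed.

(** * Walks avoiding a set before their end *)

Section FreeWalks.

Variables (T : finType) (e : rel T) (S : {set T}).

(** Walks, unlike paths, can be joined without checking that vertices are distinct. *)
Definition free_walk (u v : T) (n : nat) : Prop :=
  exists2 p : seq T, path e u p && (last u p == v) &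
    size p = n /\ {in belast u p, forall x, x \notin S}.

Lemma free_walk0 u : free_walk u u 0.
Proof. by exists [::]; rewrite //= eqxx. Qed.

Lemma free_walk_cons u u' v n :
  e u u' -> u \notin S -> free_walk u' v n -> free_walk u v n.+1.
Proof.
move=> euu uS [p /andP[ep lp] [sp freep]].
exists (u' :: p); rewrite /= ?euu ?ep //; split; first by rewrite sp.
by move=> x; rewrite inE => /predU1P[-> //|/freep].
Qed.

(** Shortening the walk to a path adds no vertices, and [v], being its last vertex, cannot be
    internal to it. *)
Lemma Sdist_free_walk u v n : v \in S -> u \notin S -> free_walk u v n ->
  exists2 k, Sdist e S u v = Some k & k <= n.
Proof.
move=> vS uS [p /andP[ep /eqP lp] [<- freep]] {n}.
have freeS x : x \in u :: p -> x != v -> x \notin S.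
  by rewrite lastI mem_rcons inE lp => /predU1P[->|/freep//]; rewrite eqxx.
move: (lp); case/shortenP: ep => q eq uq sub_qp lq.
have Pq : Spath e S u v q.
  rewrite /Spath /gpath eq lq eqxx uq /=; apply/andP; split.
    suff -> : [set u; v] :&: S = [set v] by rewrite cards1.
    apply/setP=> x; rewrite !inE.
    have [->|xv] := eqVneq x v; first by rewrite orbT.
    by case: eqP => // ->; rewrite (negPf uS).
  apply/allP=> x /mem_behead xq; apply: freeS.
    by move: (mem_belast xq); rewrite !inE => /predU1P[->|/sub_qp->];
      rewrite ?eqxx ?orbT.
  apply: contraTneq uq => xv; rewrite lastI lq rcons_uniq -xv xq //.
have := SdistP e S u v; case: Sdist => [k [_ /(_ q Pq) lek]|/(_ q)].
  exists k => //; apply: leq_trans lek _; apply: uniq_leq_size sub_qp.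
  by case/andP: uq.
by rewrite Pq.
Qed.

End FreeWalks.

(** Scaling by [2 ^ n] turns the rational sum into one over [nat]; the successor in the exponent is
    the factor 2 in the weight. *)
Lemma free_weight_ge1 (T : finType) (e : rel T) (S P : {set T}) (u : T)
    (d : T -> nat) (n : nat) :
  u \notin S -> P \subset S ->
  {in P, forall p, d p <= n /\ free_walk e S u p (d p)} ->
  2 ^ n <= \sum_(p in P) 2 ^ (n - d p).+1 ->
  (1 <= weight e S u)%R.
Proof.
move=> uS /subsetP sPS dP len.
have half_ge k m : k <= m -> (m <= n)%N ->
  (((2 ^ (n - m).+1)%N%:R / (2 ^ n)%N%:R) <= half_pow (Some k) :> rat)%R.
  move=> lekm lemn; rewrite /half_pow expfzDr // -exprnP.
  rewrite (_ : (1 / 2) ^ (- 1) = 2)%R // mulrC expr_div_n expr1n.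
  rewrite !natrX mul1r exprSr mulrA ler_pM2r // ler_pdivrMl ?exprn_gt0 //.
  by rewrite ler_pdivlMr ?exprn_gt0 // -exprD ler_eXn2l //; lia.
have half_ge0 o : (0 <= half_pow o)%R.
  by case: o => //= k; apply: exprz_ge0.
rewrite /weight (bigID (mem P)) /= -[X in (X <= _)%R]addr0.
apply: lerD; last by apply: sumr_ge0.
apply: (@le_trans _ _ (\sum_(p in P) ((2 ^ (n - d p).+1)%N%:R / (2 ^ n)%N%:R))%R).
  rewrite -mulr_suml -natr_sum ler_pdivlMr ?mul1r ?ler_nat //.
  by rewrite ltr0n expn_gt0.
rewrite (eq_bigl (fun p => p \in P)) => [|p]; last first.
  by case: (boolP (p \in P)) => [/sPS->|]; rewrite ?andbF.
apply: ler_sum => p pP; have [ledn walkp] := dP p pP.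
have [k -> lek] := Sdist_free_walk (sPS p pP) uS walkp.
exact: half_ge.
Qed.

(** * Ancestors and subtrees in a rooted tree *)

Section RootedTree.

Variables (T : finType) (e : rel T) (c : T) (par : T -> T) (dep : T -> nat).
Variable K : nat.
Hypothesis e_sym : symmetric e.
Hypothesis dep_c : dep c = 0.
Hypothesis e_par : forall u, u != c -> e u (par u).
Hypothesis dep_par : forall u, u != c -> dep u = (dep (par u)).+1.
Hypothesis dep_max : forall u, dep u <= K.+1.

(* The ancestor of [u] at depth [d]; it is [u] itself when [dep u <= d]. *)
Definition anc d u := iter (dep u - d) par u.
Definition below x := [set u | anc (dep x) u == x].

Lemma dep_gt0 u : (0 < dep u) = (u != c).
Proof. by case: eqVneq => [->|/dep_par->]; rewrite ?dep_c. Qed.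

Lemma dep_anc d u : dep (anc d u) = minn d (dep u).
Proof.
rewrite /anc; have [m] := ubnP (dep u); elim: m u => // m IHm u ltu.
have [led|ltd] := leqP (dep u) d.
  by rewrite (eqP (led : dep u - d == 0)) /=.
have uc : u != c by rewrite -dep_gt0; lia.
have du := dep_par uc; have -> : dep u - d = (dep (par u) - d).+1 by lia.
by rewrite iterSr IHm; lia.
Qed.

Lemma anc_ge d u : dep u <= d -> anc d u = u.
Proof. by rewrite /anc -subn_eq0 => /eqP->. Qed.

Lemma anc_anc d d' u : d <= d' -> anc d (anc d' u) = anc d u.
Proof.
move=> led; have [/anc_ge-> //|ltd] := leqP (dep u) d'.
by rewrite {1}/anc dep_anc /anc -iterD; congr (iter _ _ _); lia.
Qed.

Lemma par_anc d u : d < dep u -> par (anc d.+1 u) = anc d u.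
Proof. by move=> ltd; rewrite /anc -iterS subnSK. Qed.

Lemma anc_neq_c d u : d < dep u -> anc d.+1 u != c.
Proof. by rewrite -dep_gt0 dep_anc; lia. Qed.

Lemma anc0 u : anc 0 u = c.
Proof. by apply/eqP; rewrite -[_ == _]negbK -dep_gt0 dep_anc min0n. Qed.

Lemma below_dep x u : u \in below x -> dep x <= dep u.
Proof. by rewrite inE => /eqP/(congr1 dep); rewrite dep_anc; lia. Qed.

Lemma belowxx x : x \in below x.
Proof. by rewrite inE anc_ge. Qed.

Lemma below_trans x y u : y \in below x -> u \in below y -> u \in below x.
Proof.
move=> yx; have := below_dep yx; move: yx; rewrite !inE => /eqP yx le_xy /eqP uy.
by rewrite -(anc_anc u le_xy) uy yx.
Qed.

Lemma below_anc x d u : dep x <= d -> (anc d u \in below x) = (u \in below x).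
Proof. by move=> led; rewrite !inE anc_anc. Qed.

Lemma below_c u : u \in below c.
Proof. by rewrite inE dep_c anc0. Qed.

(** * Values and closed vertices *)

Definition child x y := [&& y != c, par y == x & dep y <= K].

Lemma child_dep x y : child x y -> dep y = (dep x).+1.
Proof. by case/and3P=> /dep_par -> /eqP->. Qed.

Lemma child_below x y : child x y -> y \in below x.
Proof.
move=> xy; have dy := child_dep xy; case/and3P: xy => yc /eqP py _.
by rewrite inE -par_anc ?dy // -dy anc_ge // py.
Qed.

Lemma anc_child x u :
  u \in below x -> u != x -> dep u <= K -> child x (anc (dep x).+1 u).
Proof.
move=> ux nux leu; have le := below_dep ux.
have lt : dep x < dep u.
  rewrite ltn_neqAle le andbT; apply: contra nux => /eqP dxu.
  by move: ux; rewrite inE anc_ge ?dxu.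
move: ux; rewrite inE => ux.
by rewrite /child anc_neq_c // par_anc // ux dep_anc; lia.
Qed.

(* [h] is meant to be [K - dep x]. *)
Fixpoint value_rec h x :=
  maxn (2 ^ h)
       (if h is h'.+1 then \sum_(y | child x y) value_rec h' y else 0).
Definition value x := value_rec (K - dep x) x.
Definition child_value x := \sum_(y | child x y) value y.

Lemma valueE x : dep x <= K -> value x = maxn (2 ^ (K - dep x)) (child_value x).
Proof.
rewrite /child_value /value => lex; case def_h: (K - dep x) => [|h] /=.
  rewrite big_pred0 // => y; apply/negP => xy.
  by have := child_dep xy; case/and3P: xy; lia.
congr maxn; apply: eq_bigr => y /child_dep ->.
by congr (value_rec _ _); lia.
Qed.

Definition closed_set :=
  [set x | (dep x <= K) && (child_value x < 2 ^ (K - dep x))].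

Lemma value_closed x : x \in closed_set -> value x = 2 ^ (K - dep x).
Proof. by rewrite inE => /andP[/valueE-> /ltnW/maxn_idPl]. Qed.

Lemma value_open x : dep x <= K -> x \notin closed_set ->
  value x = child_value x /\ 2 ^ (K - dep x) <= value x.
Proof.
move=> lex; rewrite inE lex -leqNgt /= => le2.
by rewrite valueE // (maxn_idPr le2).
Qed.

Lemma closed_level x : dep x = K -> x \in closed_set.
Proof.
move=> dx; rewrite inE dx leqnn subnn /child_value big_pred0 // => y.
by apply/negP => xy; have := child_dep xy; case/and3P: xy; lia.
Qed.

Lemma depth_ind (P : T -> Prop) :
  (forall x, dep x <= K -> (forall y, child x y -> P y) -> P x) ->
  forall x, dep x <= K -> P x.
Proof.
move=> IH x; have [m] := ubnP (K - dep x); elim: m x => // m IHm x ltm lex.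
apply: IH => // y xy; apply: IHm; have := child_dep xy; case/and3P: xy; lia.
Qed.

(** Closed vertices other than [x] are distributed among the subtrees of the children, so
    [child_value x] bounds their number. If [x] is closed, the strict inequality leaves room for [x]
    itself. *)
Lemma card_closed_below x : dep x <= K -> #|closed_set :&: below x| <= value x.
Proof.
move: x; apply: depth_ind => x lex IHx.
have sub : (closed_set :\ x) :&: below x
    \subset \bigcup_(y | child x y) (closed_set :&: below y).
  apply/subsetP => u /setIP[/setD1P[nux uC] ux].
  have leu : dep u <= K by move: uC; rewrite inE => /andP[].
  apply/bigcupP; exists (anc (dep x).+1 u); first exact: anc_child.
  have /child_dep dy := anc_child ux nux leu.
  by rewrite inE uC inE dy eqxx.
have le_ch : #|(closed_set :\ x) :&: below x| <= child_value x.
  apply: leq_trans (subset_leq_card sub) _.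
  by apply: leq_trans (card_bigcup_le _ _) _; apply: leq_sum.
have [xC|xC] := boolP (x \in closed_set); last first.
  have [-> _] := value_open lex xC; congr (_ <= _): le_ch.
  congr #|pred_of_set (_ :&: _)|; apply/setP => y; rewrite !inE.
  by case: eqVneq => // ->; rewrite inE in xC; rewrite (negPf xC).
rewrite value_closed // (cardsD1 x) inE xC belowxx.
move: (xC); rewrite inE => /andP[_]; apply: leq_trans.
by rewrite ltnS; congr (_ <= _): le_ch; rewrite setIDAC.
Qed.

(** * Topmost closed vertices of a subtree *)

Definition tops x := [set p in closed_set :&: below x |
  [forall j : 'I_(dep p), (dep x <= j) ==> (anc j p \notin closed_set)]].

Lemma topsP x p : reflect [/\ p \in closed_set, p \in below x &
    forall j, dep x <= j < dep p -> anc j p \notin closed_set] (p \in tops x).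
Proof.
apply: (iffP setIdP) => [[/setIP[pC px] /forallP top]|[pC px top]].
  split=> // j /andP[lej ltj].
  by have /implyP := top (Ordinal ltj); apply.
split; first exact/setIP.
by apply/forallP=> j; apply/implyP => lej; apply: top; rewrite lej /=.
Qed.

(** If [x] is closed, it is its own only top; if it is open, its tops are the disjoint union of
    those of its children. *)
Lemma tops_value x : dep x <= K -> \sum_(p in tops x) 2 ^ (K - dep p) = value x.
Proof.
move: x; apply: depth_ind => x lex IHx.
have [xC|xC] := boolP (x \in closed_set).
  rewrite value_closed // (big_pred1 x) // => p; apply/topsP/eqP => [|->].
    case=> pC px top; apply/eqP; apply: contraT => npx.
    have := top (dep x); rewrite leqnn /=.
    move: (px); rewrite inE => /eqP->; rewrite xC; apply.
    have lep : dep p <= K by move: pC; rewrite inE => /andP[].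
    by have /child_dep := anc_child px npx lep; rewrite dep_anc; lia.
  by split=> // [|j]; [exact: belowxx|lia].
have [-> _] := value_open lex xC.
rewrite (partition_big (anc (dep x).+1) (child x)) /= => [|p]; last first.
  case/topsP=> pC px _; apply: anc_child => //.
    by apply: contraNneq xC => <-.
  by move: pC; rewrite inE => /andP[].
apply: eq_bigr => y xy; rewrite -IHx //; apply: eq_bigl => p.
have dy := child_dep xy.
apply/andP/topsP => [[/topsP[pC px top] /eqP py]|[pC py top]].
  by split=> // [|j]; [rewrite inE dy py|move=> ?; apply: top; lia].
split; last by move: py; rewrite inE dy.
apply/topsP; split => // [|j /andP[lej ltj]].
  exact: below_trans (child_below xy) py.
move: lej; rewrite leq_eqVlt => /predU1P[<-|lej]; last by apply: top; lia.
by have /(below_trans (child_below xy)) := py; rewrite inE => /eqP->.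
Qed.

(** * Walks in the tree and domination *)

Lemma walk_down (S : {set T}) x p : p \in below x ->
  (forall j, dep x <= j < dep p -> anc j p \notin S) ->
  free_walk e S x p (dep p - dep x).
Proof.
rewrite inE => /eqP px; rewrite -{2}px.
(* The start is now [anc (dep x) p]; generalizing its depth to [d] lets the induction descend the
   branch to [p]. *)
elim: (dep p - dep x) {-2}(dep x) (erefl (dep p - dep x)) => [|n IHn] d def_n free.
  by rewrite def_n anc_ge; [exact: free_walk0|lia].
have ltd : d < dep p by lia.
rewrite -subnSK //.
apply: (@free_walk_cons _ _ _ _ (anc d.+1 p)).
- by rewrite e_sym -(par_anc ltd) e_par // anc_neq_c.
- by apply: free; lia.
- by apply: IHn => [|j ?]; [lia|apply: free; lia].
Qed.

Lemma walk_up (S : {set T}) u v n : (forall j, j <= dep u -> anc j u \notin S) ->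
  free_walk e S c v n -> free_walk e S u v (dep u + n).
Proof.
move=> + cv; have [m] := ubnP (dep u); elim: m u => // m IHm u ltm free.
have [->|uc] := eqVneq u c; first by rewrite dep_c.
have du := dep_par uc; rewrite du.
apply: (@free_walk_cons _ _ _ _ (par u)); first exact: e_par.
  by rewrite -(anc_ge (leqnn (dep u))) free.
apply: IHm => [|j lej]; first by lia.
rewrite -[u](anc_ge (leqnn (dep u))) du par_anc ?anc_anc ?free //; lia.
Qed.

(** Applied with [x] the root when all closed vertices are taken, and with [x] in [P] otherwise.
    Since [S] has only closed vertices, open ones never block a walk. *)
Lemma closed_below_weight (S : {set T}) x u : dep x <= K ->
  closed_set :&: below x \subset S -> S \subset closed_set ->
  u \in below x -> (1 <= weight e S u)%R.
Proof.
move=> lex /subsetP sxS /subsetP sSC ux.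
have [uS|uS] := boolP (u \in S); first by rewrite weight_in.
have [leu|ltu] := leqP (dep u) K.
  have uC : u \notin closed_set.
    by apply: contra uS => uC; apply: sxS; rewrite inE uC.
  have topP p : p \in tops u -> p \in S.
    case/topsP=> pC pu _; apply: sxS; rewrite inE pC.
    exact: below_trans ux pu.
  have [_ le2] := value_open leu uC.
  (* With this [n], a top [p] at distance [dep p - dep u] has [n - d p = K - dep p], its weight in
     [tops_value]. *)
  apply: (@free_weight_ge1 _ _ _ (tops u) _ (fun p => dep p - dep u) (K - dep u)).
  - by [].
  - by apply/subsetP.
  - move=> p /topsP[pC pu top]; split.
      by move: pC; rewrite inE => /andP[]; lia.
    apply: walk_down => // j jP; apply: contra (top j jP); exact: sSC.
  - apply: leq_trans le2 _; rewrite -tops_value //; apply: leq_sum => p.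
    case/topsP=> _ /below_dep lep _; rewrite leq_exp2l //; lia.
(* At the bottom level, the closed parent alone gives weight 1. *)
have du : dep u = K.+1 by have := dep_max u; lia.
have uc : u != c by rewrite -dep_gt0 du.
have parC : par u \in closed_set.
  by apply: closed_level; have := dep_par uc; lia.
have parS : par u \in S.
  apply: sxS; rewrite inE parC -[u](@anc_ge K.+1) ?du // par_anc ?du //.
  by rewrite below_anc.
apply: (@free_weight_ge1 _ _ _ [set par u] _ (fun=> 1) 1) => //.
- by rewrite sub1set.
- move=> _ /set1P->; split=> //; apply: free_walk_cons (free_walk0 _ _ _) => //.
  exact: e_par.
- by rewrite big_set1.
Qed.

Lemma tree_exp_dominating :
  exists2 S : {set T}, exp_dominating e S & #|S| <= 2 ^ (2 * K).
Proof.
have lec : dep c <= K by rewrite dep_c.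
have [le4|lt4] := leqP (value c) (2 ^ (2 * K)).
  exists closed_set.
    apply/forallP => u; apply: (@closed_below_weight _ c) => //.
      exact: subsetIl.
    exact: below_c.
  apply: leq_trans le4; apply: leq_trans (card_closed_below lec).
  by apply/subset_leq_card/subsetP => u uC; rewrite inE uC below_c.
move: (ltnW lt4); rewrite -tops_value //.
case/exact_pow2_subset => [p _|P /subsetP sP sumP]; first by lia.
have PC p : p \in P -> p \in closed_set by case/sP/topsP.
have PK p : p \in P -> dep p <= K by move/PC; rewrite inE => /andP[].
pose S := \bigcup_(p in P) (closed_set :&: below p).
have sSC : S \subset closed_set by apply/bigcupsP => p _; apply: subsetIl.
have sPS : P \subset S.
  by apply/subsetP=> p pP; apply/bigcupP; exists p => //; rewrite inE PC ?belowxx.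
exists S; last first.
  apply: leq_trans (card_bigcup_le _ _) _; rewrite -sumP; apply: leq_sum => p pP.
  by rewrite -value_closed ?PC //; apply: card_closed_below; apply: PK.
apply/forallP => u.
have [/exists_inP[p pP up]|] := boolP [exists p in P, u \in below p].
  apply: (@closed_below_weight _ p) => //; first exact: PK.
  exact: (bigcup_sup p).
rewrite negb_exists_in => /forall_inP upP.
(* An ancestor of [u] in [S] would lie below some [p] in [P], and hence so would [u]. *)
have freeu j : anc j u \notin S.
  apply/negP => /bigcupP[p pP /setIP[_ jp]].
  have lej := below_dep jp; rewrite dep_anc in lej.
  by have := upP p pP; rewrite -(@below_anc p j) ?jp //; lia.
(* The length is at most [K.+1 + K], and [dep u <= K.+1] makes each exponent at least
   [(K - dep p).+1], for a total of at least [2 * 4 ^ K]. *)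
apply: (@free_weight_ge1 _ _ _ P _ (fun p => dep u + dep p) (2 * K).+1) => //.
- by have := freeu (dep u); rewrite anc_ge.
- move=> p pP; split; first by have := PK p pP; have := dep_max u; lia.
  apply: walk_up => //.
  have /topsP[_ pc top] := sP p pP.
  rewrite -[dep p]subn0 -dep_c; apply: walk_down => // j jP.
  by apply: contra (top j jP); apply/subsetP.
- rewrite expnS -sumP big_distrr /=; apply: leq_sum => p pP.
  by rewrite -expnS leq_exp2l //; have := PK p pP; have := dep_max u; lia.
Qed.

End RootedTree.

(** * Shortest-path tree from a central vertex *)

Theorem theorem3 (T : finType) (e : rel T)
    (graph_e : simple_graph e) (conn_e : connected_graph e)
    (rad_ge1 : 1 <= radius e) :
  gamma_e e <= 2 ^ (2 * radius e - 2).
Proof.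
have [c ecc_c] := (radiusP conn_e).1; have [sym_e _] := graph_e.
pose dep u := odflt 0 (gdist e c u).
(* The default is reached only at [c], which has no neighbour of smaller depth. *)
pose par u := odflt u [pick v | e u v & (dep v).+1 == dep u].
have parP u : u != c -> e u (par u) /\ dep u = (dep (par u)).+1.
  move=> uc; rewrite /par; case: pickP => [v /andP[euv /eqP->]|noparent] //=.
  have [v euv dv] := gdist_predecessor sym_e (conn_e.2 c u) uc.
  by have := noparent v; rewrite euv dv eqxx.
have [] := @tree_exp_dominating T e c par dep (radius e).-1 sym_e.
- rewrite /dep; have := gdistP e c c; case: gdist => //= k [_ /(_ [::])].
  by rewrite /gpath /= eqxx => /(_ isT); lia.
- by move=> u /parP[].
- by move=> u /parP[].
- move=> u; rewrite prednK // -ecc_c /dep.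
  have [k duk _] := gdist_connected c u conn_e; rewrite duk /=.
  exact: (eccP c conn_e).2 duk.
move=> S domS leS; apply: leq_trans ((gamma_eP e).2 S domS) _.
by rewrite (leq_trans leS) // leq_exp2l //; lia.
Qed.
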